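(* The category $\mathbf{KBSob}$ of all $k$-bounded sober spaces and continuous mappings is not a reflective subcategory of the category $\mathbf{Top}_0$ of all $T_0$ spaces and continuous mappings.
   Context: For a $T_0$ space $X$ the specialization order is the partial order $x\le y$ iff $x\in \mathrm{cl}(\{y\})$; all suprema $\bigvee$ in $X$ are taken with respect to this order. A non-empty subset $F$ of a topological space $X$ is irreducible if whenever $F\subseteq A\cup B$ with $A,B$ closed in $X$, then $F\subseteq A$ or $F\subseteq B$. A $T_0$ space $X$ is $k$-bounded sober if for every irreducible closed subset $F$ of $X$ whose supremum $\bigvee F$ exists, there is a unique point $x\in X$ with $F=\mathrm{cl}(\{x\})$. A subcategory $\mathbf A$ of a category $\mathbf B$ is reflective if for every object $B$ of $\mathbf B$ there are an object $\overline B$ of $\mathbf A$ and a $\mathbf B$-morphism $r:B\to\overline B$ such that for every $\mathbf B$-morphism $f:B\to A$ with $A$ an object of $\mathbf A$ there is a unique $\mathbf A$-morphism $\bar f:\overline B\to A$ with $\bar f\circ r=f$. *)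

(* Defs.v *)
From HB Require Import structures.
From mathcomp Require Import all_boot all_order.
From mathcomp Require Import boolp classical_sets topology.

Set Implicit Arguments.
Unset Strict Implicit.
Unset Printing Implicit Defensive.

Local Open Scope classical_set_scope.

Record category := Category {
  Ob :> Type;
  Hom : Ob -> Ob -> Type;
  idm : forall X, Hom X X;
  compm : forall X Y Z, Hom Y Z -> Hom X Y -> Hom X Z;
  comp1m : forall X Y (f : Hom X Y), compm (idm Y) f = f;
  compm1 : forall X Y (f : Hom X Y), compm f (idm X) = f;
  compmA : forall W X Y Z (h : Hom Y Z) (g : Hom X Y) (f : Hom W X),
    compm h (compm g f) = compm (compm h g) f
}.

Arguments idm {c} X.
Arguments compm {c X Y Z} g f : rename.

(** [sub_hom f] is only relevant when the source and the target of [f] both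
    satisfy [sub_ob]. *)
Record subcategory (B : category) := Subcategory {
  sub_ob : B -> Prop;
  sub_hom : forall X Y : B, Hom X Y -> Prop;
  sub_hom_id : forall X, sub_ob X -> sub_hom (idm X);
  sub_hom_comp : forall X Y Z (g : Hom Y Z) (f : Hom X Y),
    sub_ob X -> sub_ob Y -> sub_ob Z ->
    sub_hom g -> sub_hom f -> sub_hom (compm g f)
}.

Definition full_subcategory (B : category) (P : B -> Prop) : subcategory B :=
  @Subcategory B P (fun _ _ _ => True) (fun _ _ => I)
    (fun _ _ _ _ _ _ _ _ _ _ => I).

Definition reflective (B : category) (S : subcategory B) : Prop :=
  forall X : B, exists Xbar : B, sub_ob S Xbar /\
    exists r : Hom X Xbar, forall (A : B) (f : Hom X A), sub_ob S A ->
      exists! fbar : Hom Xbar A, sub_hom S fbar /\ compm fbar r = f.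

Record t0Space := T0Space {
  t0_sort :> topologicalType;
  t0P : kolmogorov_space t0_sort
}.

Definition cts_id_hom (X : t0Space) : continuousType X X := @idfun X.

Definition cts_comp_hom (X Y Z : t0Space)
  (g : continuousType Y Z) (f : continuousType X Y) : continuousType X Z :=
  g \o f.

Lemma cts_comp1 (X Y : t0Space) (f : continuousType X Y) :
  cts_comp_hom (cts_id_hom Y) f = f.
Proof. exact/continuousEP. Qed.

Lemma cts_compr1 (X Y : t0Space) (f : continuousType X Y) :
  cts_comp_hom f (cts_id_hom X) = f.
Proof. exact/continuousEP. Qed.

Lemma cts_compA (W X Y Z : t0Space) (h : continuousType Y Z)
  (g : continuousType X Y) (f : continuousType W X) :
  cts_comp_hom h (cts_comp_hom g f) = cts_comp_hom (cts_comp_hom h g) f.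
Proof. exact/continuousEP. Qed.

Definition Top0 : category :=
  @Category t0Space (fun X Y => continuousType X Y) cts_id_hom cts_comp_hom
    cts_comp1 cts_compr1 cts_compA.

(** Alias of the points of [X] that carries the specialization order, so that
    [supremums] from the order library applies. *)
Definition specialization (X : t0Space) : Type := X.

HB.instance Definition _ (X : t0Space) := Choice.on (specialization X).

Definition spec_le (X : t0Space) (x y : specialization X) : bool :=
  `[< closure [set (y : X)] (x : X) >].

Lemma spec_le_refl (X : t0Space) : reflexive (@spec_le X).
Proof. by move=> x; apply/asboolP; exact: subset_closure. Qed.

Lemma spec_le_anti (X : t0Space) : antisymmetric (@spec_le X).
Proof.
move=> x y /andP[/asboolP xy /asboolP yx]; apply/eqP; apply: contrapT.
move=> /negP /(@t0P X)[A [[]|[]]]; rewrite !inE => nA /= An.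
- by have [z [/= -> /An]] := xy A nA.
- by have [z [/= -> /An]] := yx A nA.
Qed.

Lemma spec_le_trans (X : t0Space) : transitive (@spec_le X).
Proof.
move=> y x z /asboolP xy /asboolP yz; apply/asboolP.
rewrite ((closure_id _).1 (@closed_closure X [set z])).
by apply: closure_subset xy => _ ->.
Qed.

Fact specialization_display : Order.disp_t. Proof. exact: Order.Disp tt tt. Qed.

HB.instance Definition _ (X : t0Space) :=
  Order.Le_isPOrder.Build specialization_display (specialization X)
    (@spec_le_refl X) (@spec_le_anti X) (@spec_le_trans X).

Definition irreducible_set (X : topologicalType) (F : set X) : Prop :=
  F !=set0 /\
  forall A B : set X, closed A -> closed B ->
    F `<=` A `|` B -> F `<=` A \/ F `<=` B.

Definition has_supremum (X : t0Space) (F : set X) : Prop :=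
  supremums (F : set (specialization X)) !=set0.

Definition k_bounded_sober (X : t0Space) : Prop :=
  forall F : set X, closed F -> irreducible_set F -> has_supremum F ->
    exists! x : X, F = closure [set x].

Definition KBSob : subcategory Top0 :=
  @full_subcategory Top0 k_bounded_sober.

(* Main.v *)
From HB Require Import structures.
From mathcomp Require Import all_boot all_order.
From mathcomp Require Import boolp classical_sets topology.
Require Import Defs.

(** A reflective full subcategory closed under isomorphisms is closed under
    retracts.  The poset [nat] with one top element, in its Alexandrov
    topology, is a retract of [nat] with two incomparable upper bounds.  In the
    latter the closed irreducible set [nat] has no supremum, so the space is
    k-bounded sober; in the former it has one but no generic point. *)

Set Implicit Arguments.
Unset Strict Implicit.
Unset Printing Implicit Defensive.

Local Open Scope classical_set_scope.

(** The inclusion [i] factors as [j] after the reflection [r], so [q] after [j] is a left inverse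
    [s] of [r]. Both [compm r s] and [idm Z] factor [r] through itself, hence uniqueness makes them
    equal and [X] is isomorphic to its reflection. *)
Lemma reflective_retract (B : category) (P : B -> Prop) (X Y : B)
    (i : Hom X Y) (q : Hom Y X) :
  reflective (full_subcategory P) -> P Y -> compm q i = idm X ->
  exists2 Z : B, P Z & exists (r : Hom X Z) (s : Hom Z X),
    compm s r = idm X /\ compm r s = idm Z.
Proof.
move=> /(_ X)[Z [PZ [r univ]]] PY qi; exists Z => //.
have [j [[_ jr] _]] := univ Y i PY.
have sr : compm (compm q j) r = idm X by rewrite -compmA jr.
exists r, (compm q j); split=> //.
have [k [_ k_uniq]] := univ Z r PZ.
rewrite -(k_uniq (idm Z)); last by rewrite comp1m.
by apply/esym/k_uniq; rewrite -compmA sr compm1.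
Qed.

Lemma continuous_closure1 (X Y : topologicalType) (f : X -> Y) (x y : X) :
  continuous f -> closure [set y] x -> closure [set f y] (f x).
Proof.
move=> cf yx V /cf fV.
by have [_ [-> Vy]] := yx _ fV; exists (f y).
Qed.

Lemma closed_closure1 (X : topologicalType) (F : set X) (x : X) :
  closed F -> F x -> closure [set x] `<=` F.
Proof.
by move=> Fc Fx; rewrite [F](closure_id _).1//; apply: closureS => _ ->.
Qed.

Lemma closure1_inj (X : t0Space) : injective (fun x : X => closure [set x]).
Proof.
move=> x y /= xy; apply: (@spec_le_anti X); apply/andP.
by split; apply/asboolP; [rewrite -xy|rewrite xy]; exact: subset_closure.
Qed.

(** Continuous maps are monotone for specialization. So a supremum [u] of [F] becomes the supremum
    [r u] of the preimage of [F] under [s], and a generic point [z] there comes back as [s z]. *)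
Lemma k_bounded_sober_iso (X Z : t0Space) (r : continuousType X Z)
    (s : continuousType Z X) :
  cancel r s -> cancel s r -> k_bounded_sober Z -> k_bounded_sober X.
Proof.
move=> rK sK Zsob F Fc [[x0 Fx0] Firr] [u [Fu uF]].
have rc : continuous r by exact: cts_fun.
have sc : continuous s by exact: cts_fun.
have [] := Zsob (s @^-1` F).
- exact: (continuous_closedP s).1.
- split=> [|A B Ac Bc FAB]; first by exists (r x0); rewrite /= rK.
  have [||x Fx|FA|FB] := Firr (r @^-1` A) (r @^-1` B).
  + exact: (continuous_closedP r).1.
  + exact: (continuous_closedP r).1.
  + by apply: FAB; rewrite /= rK.
  + by left=> z /FA; rewrite /= sK.
  + by right=> z /FB; rewrite /= sK.
- exists (r u); split=> [z Fz|v vF]; apply/asboolP.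
    by rewrite -[z]sK; apply: continuous_closure1 => //; exact/asboolP/Fu.
  rewrite -[v]sK; apply: continuous_closure1 => //; apply/asboolP/uF => x Fx.
  apply/asboolP; rewrite -[x]rK; apply: continuous_closure1 => //.
  by apply/asboolP/vF; rewrite /= rK.
move=> z [Fz _]; have Fsz : F = closure [set s z].
  apply/seteqP; split=> [x Fx|].
    rewrite -[x]rK; apply: continuous_closure1 => //.
    by rewrite -Fz /= rK.
  apply: closed_closure1 => //.
  by have : (s @^-1` F) z by rewrite Fz; exact: subset_closure.
by exists (s z); split=> // y Fy; apply: closure1_inj; rewrite /= -Fsz.
Qed.

(** The points of [B] form an antichain above the chain [nat]: [unit] gives the single top, [bool]
    the two incomparable upper bounds. *)
Definition tower (B : choiceType) : Type := (nat + B)%type.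

HB.instance Definition _ (B : choiceType) := Choice.on (tower B).

Section Tower.
Variable B : choiceType.

Definition tower_le (x y : tower B) : bool :=
  match x, y with
  | inl m, inl n => (m <= n)%N
  | inl _, inr _ => true
  | inr _, inl _ => false
  | inr b, inr c => b == c
  end.

Lemma tower_le_refl : reflexive tower_le.
Proof. by case=> /=. Qed.

Lemma tower_le_anti : antisymmetric tower_le.
Proof.
case=> [m|b] [n|c] //=; first by move=> /anti_leq ->.
by move=> /andP[/eqP->].
Qed.

Lemma tower_le_trans : transitive tower_le.
Proof.
case=> [m|b] [n|c] [p|d] //=; first exact: leq_trans.
by move=> /eqP -> /eqP ->.
Qed.

(** These are the open sets of the Alexandrov topology, whose closed sets are the down-sets and
    whose specialization order is [tower_le] itself. *)
Definition upper (U : set (tower B)) : Prop :=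
  forall x y, tower_le x y -> U x -> U y.

Lemma upperT : upper setT. Proof. by []. Qed.

Lemma upperI : setI_closed upper.
Proof. by move=> U V Uu Vu x y xy [/Uu-/(_ _ xy) ? /Vu-/(_ _ xy) ?]. Qed.

Lemma upper_bigcup (I : Type) (U : I -> set (tower B)) :
  (forall i, upper (U i)) -> upper (\bigcup_i U i).
Proof. by move=> Uu x y xy [i _ /Uu-/(_ _ xy)]; exists i. Qed.

HB.instance Definition _ :=
  isOpenTopological.Build (tower B) upperT upperI upper_bigcup.

Lemma tower_openE (U : set (tower B)) : open U = upper U.
Proof. by []. Qed.

Lemma tower_closedP (F : set (tower B)) :
  closed F <-> forall x y, tower_le x y -> F y -> F x.
Proof.
rewrite -openC tower_openE; split=> [Fo x y xy Fy|Fl x y xy nFx /(Fl _ _ xy)//].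
by apply: contrapT => nFx; exact: Fo xy nFx Fy.
Qed.

Lemma closure_tower1 (y : tower B) :
  closure [set y] = [set x | tower_le x y].
Proof.
apply/seteqP; split=> [|x xy].
  apply: closed_closure1; last exact: tower_le_refl.
  by apply/tower_closedP => x z xz /= /(tower_le_trans xz).
apply: (tower_closedP _).1 xy _; first exact: closed_closure.
exact: subset_closure.
Qed.

Lemma tower_kolmogorov : kolmogorov_space (tower B).
Proof.
move=> x y xy; have /nandP : ~~ (tower_le x y && tower_le y x).
  by apply: contra xy => /tower_le_anti ->.
have nbhs_cone z : [set t | tower_le z t] \in nbhs z.
  rewrite inE; apply: open_nbhs_nbhs; split; last exact: tower_le_refl.
  by rewrite tower_openE => t u tu /tower_le_trans; exact.
case=> [nxy|nyx].
  exists [set t | tower_le x t]; left; rewrite nbhs_cone inE.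
  by split=> //; exact/negP.
exists [set t | tower_le y t]; right; rewrite nbhs_cone inE.
by split=> //; exact/negP.
Qed.

Definition towerT0 : t0Space := T0Space tower_kolmogorov.

Lemma spec_le_tower (x y : towerT0) : spec_le x y = tower_le x y.
Proof. by apply/asboolP/idP; rewrite closure_tower1. Qed.

(** A non-empty down-set of a finite initial segment of the chain has a greatest element, and is its
    principal down-set. *)
Lemma tower_bounded_generic (F : set (tower B)) (n : nat) :
  F !=set0 -> closed F -> F `<=` [set x | tower_le x (inl n)] ->
  exists x, F = closure [set x].
Proof.
move=> [x0 Fx0] /tower_closedP Fl Fn.
have [m0 m0E] : exists m, x0 = inl m.
  by case: x0 Fx0 => [m _|b /Fn//]; exists m.
have [||m /asboolP Fm mmax] := @ex_maxnP (fun m => `[< F (inl m) >]) n.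
- by exists m0; apply/asboolP; rewrite -m0E.
- by move=> m /asboolP /Fn.
exists (inl m); rewrite closure_tower1; apply/seteqP; split=> [[p|b]|x].
- by move=> Fp; apply: mmax; exact/asboolP.
- by move=> /Fn.
- by move=> /Fl; exact.
Qed.

(** As [inr b] is maximal, its complement is a down-set. Together with the closure of [inr b] it
    covers [F], and irreducibility leaves only the closure. *)
Lemma tower_top_generic (F : set (tower B)) (b : B) :
  closed F -> irreducible_set F -> F (inr b) ->
  F = closure [set inr b : tower B].
Proof.
move=> Fc [_ Firr] Fb; apply/seteqP; split; last exact: closed_closure1.
have [||x _||/(_ _ Fb)] :=
  Firr (closure [set inr b : tower B]) [set~ inr b : tower B].
- exact: closed_closure.
- by apply/tower_closedP => -[m|c] [n|d] //= /eqP ->.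
- by have [->|] := pselect (x = inr b); [left; exact: subset_closure|right].
- by [].
- by move=> /(_ erefl).
Qed.

End Tower.

Lemma tower_bool_sober : k_bounded_sober (towerT0 bool).
Proof.
(* Uniqueness is automatic in a T0 space, where the closure of a point determines it. *)
move=> F Fc Firr [s [sF Fs]]; suff [x Fx] : exists x, F = closure [set x].
  by exists x; split=> // y Fy; apply: closure1_inj; rewrite /= -Fx.
have [[b Fb]|nFb] := pselect (exists b, F (inr b)).
  by exists (inr b); exact: tower_top_generic.
have Fnat x : F x -> exists m, x = inl m.
  by case: x => [m _|b Fb]; [exists m|case: nFb; exists b].
case: s sF Fs => [n|b] sF Fs.
  apply: (@tower_bounded_generic _ _ n) => //; first exact: Firr.1.
  by move=> x /sF; rewrite /Order.le /= spec_le_tower.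
(* Here [F] lies in the chain, so the other upper point also bounds it, and leastness of [inr b]
   would make the two comparable. *)
have : spec_le (inr b : towerT0 bool) (inr (~~ b) : towerT0 bool).
  by apply: Fs => x /Fnat[m ->]; rewrite /Order.le /= spec_le_tower.
by rewrite spec_le_tower; case: b {sF Fs}.
Qed.

Definition tower_map (B C : choiceType) (h : B -> C) (x : tower B) : tower C :=
  match x with inl n => inl n | inr b => inr (h b) end.

Lemma tower_map_continuous (B C : choiceType) (h : B -> C) :
  continuous (tower_map h : towerT0 B -> towerT0 C).
Proof.
apply/continuousP => U; rewrite !tower_openE => Uu x y xy; apply: Uu.
by case: x y xy => [m|b] [n|c] //= /eqP ->.
Qed.

HB.instance Definition _ (B C : choiceType) (h : B -> C) :=
  isContinuous.Build (towerT0 B) (towerT0 C) (tower_map h)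
    (@tower_map_continuous B C h).

Lemma tower_unit_not_sober : ~ k_bounded_sober (towerT0 unit).
Proof.
(* This is the chain [nat], written as the complement of the top. *)
pose F : set (tower unit) := [set x | ~~ tower_le (inr tt) x].
have Fl m : F (inl m) by [].
have Fr : ~ F (inr tt) by [].
move=> /(_ F)[].
- by apply/tower_closedP => -[m|[]] [n|[]].
- split; first by exists (inl 0).
  move=> P Q /tower_closedP Pl /tower_closedP Ql FPQ.
  (* If [P] misses [m], it misses everything above [m]; so [Q] contains every [maxn m n], and with
     it every [n]. *)
  have [PN|/existsNP[m nPm]] := pselect (forall m, P (inl m)).
    by left=> -[m|[]].
  right=> -[n|[]] // _.
  have [Pmn|] := FPQ (inl (maxn m n)) (Fl _).
    by case: nPm; apply: Pl Pmn; exact: leq_maxl.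
  by apply: Ql; exact: leq_maxr.
- exists (inr tt); split=> x.
    by rewrite /Order.le /= spec_le_tower; case: x => [|[]].
  case: x => [m|[]] xF; rewrite /Order.le /= spec_le_tower //=.
  by move: (xF (inl m.+1) (Fl _)); rewrite /Order.le /= spec_le_tower /= ltnn.
(* The closure of [inl m] misses [m.+1], while that of the top contains the top. *)
move=> [m|[]] [Fx _].
  by have := Fl m.+1; rewrite Fx closure_tower1 /= ltnn.
by apply: Fr; rewrite Fx; exact: subset_closure.
Qed.

Theorem theorem3p4 : ~ reflective KBSob.
Proof.
move=> /reflective_retract refl.
(* The map [i] sends the top to one chosen upper point, and [q] collapses both upper points to the
   top. *)
pose i : @Hom Top0 (towerT0 unit) (towerT0 bool) :=
  tower_map (fun=> true) : continuousType _ _.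
pose q : @Hom Top0 (towerT0 bool) (towerT0 unit) :=
  tower_map (fun=> tt) : continuousType _ _.
have [||Z Zsob [r [s [sr rs]]]] := refl _ _ i q.
- exact: tower_bool_sober.
- by apply/continuousEP; case=> [n|[]].
apply: tower_unit_not_sober.
apply: (k_bounded_sober_iso (r := r) (s := s)) Zsob.
- by move=> x; exact: (continuousEP _ _).1 sr x.
- by move=> x; exact: (continuousEP _ _).1 rs x.
Qed.
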